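(* Let $n\ge 2$ and let $s_1<s_2<\dots<s_n$ be distinct non-negative real numbers. A permutation of $s=(s_1,\dots,s_n)$ has maximal loop cost (among all permutations of $s$) if and only if it is loop-equivalent to the permutation of $s$ that is order-isomorphic to \[2,\ 4,\ 6,\ 8,\ \ldots,\ n,\ \ldots,\ 7,\ 5,\ 3,\ 1\] (all even numbers in $\{1,\dots,n\}$ in increasing order followed by all odd numbers in $\{1,\dots,n\}$ in decreasing order). The same order provides the maximal pairwise cost. If $s_1>0$, this order providing the maximal pairwise cost is unique up to pairwise-equivalence. If $s_1=0$, the maximal pairwise cost is also achieved for the permutation of $s$ order-isomorphic to \[1,\ 2,\ 4,\ 6,\ 8,\ \ldots,\ n,\ \ldots,\ 7,\ 5,\ 3\] ($1$, then all even numbers in increasing order, then all odd numbers greater than $1$ in decreasing order) and for the reverse of it.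
   Context: For $\vec v=(v_1,\dots,v_n)$ with $n\ge2$: the pairwise cost is $C_P(\vec v)=v_1v_2+v_2v_3+\cdots+v_{n-1}v_n$ and the loop cost is $C_L(\vec v)=v_1v_2+v_2v_3+\cdots+v_{n-1}v_n+v_nv_1$. Two sequences are loop-equivalent if one can be obtained from the other by rotations (cyclic shifts) and reflections (reversal); they are pairwise-equivalent if they are equal or reflections of each other. A sequence $\vec v$ of distinct reals is order-isomorphic to a permutation $\pi=(p_1,\dots,p_n)$ of $\{1,\dots,n\}$ if $p_i<p_j\iff v_i<v_j$ for all $i,j$. *)

(* Defs.v *)
From HB Require Import structures.
From mathcomp Require Import all_boot all_order all_algebra.
From mathcomp Require Import reals.

Set Implicit Arguments.
Unset Strict Implicit.
Unset Printing Implicit Defensive.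

Import Order.TTheory GRing.Theory Num.Theory.
Local Open Scope ring_scope.

(* Sequences are 0-indexed: v_i is v`_(i - 1). *)

Definition pairwise_cost (R : realType) (v : seq R) : R :=
  \sum_(0 <= i < (size v).-1) v`_i * v`_i.+1.

Definition loop_cost (R : realType) (v : seq R) : R :=
  pairwise_cost v + v`_(size v).-1 * v`_0.

Inductive loop_equiv (T : Type) (v : seq T) : seq T -> Prop :=
| loop_equiv_refl : loop_equiv v v
| loop_equiv_rot (k : nat) (w : seq T) :
    loop_equiv v w -> loop_equiv v (rot k w)
| loop_equiv_rev (w : seq T) :
    loop_equiv v w -> loop_equiv v (rev w).

Definition pairwise_equiv (T : Type) (v w : seq T) : Prop :=
  v = w \/ v = rev w.

(* The first two clauses are the standing assumptions of the notion: v has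
   distinct entries and p is a permutation of {1, ..., size v}. *)
Definition order_isomorphic (R : realType) (v : seq R) (p : seq nat) : Prop :=
  [/\ uniq v,
      perm_eq p (iota 1 (size v)) &
      forall i j : nat, (i < size v)%N -> (j < size v)%N ->
        ((nth 0%N p i < nth 0%N p j)%N <-> v`_i < v`_j)].

Definition arranged_as (R : realType) (s : seq R) (p : seq nat) (v : seq R) :
    Prop :=
  perm_eq v s /\ order_isomorphic v p.

Definition has_maximal (R : realType) (C : seq R -> R) (s v : seq R) : Prop :=
  perm_eq v s /\ forall w : seq R, perm_eq w s -> C w <= C v.

(* 2, 4, 6, ..., n, ..., 5, 3, 1 *)
Definition loop_pattern (n : nat) : seq nat :=
  [seq k <- iota 1 n | ~~ odd k] ++ rev [seq k <- iota 1 n | odd k].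

(* 1, 2, 4, 6, ..., n, ..., 5, 3 *)
Definition shifted_pattern (n : nat) : seq nat :=
  1%N :: [seq k <- iota 1 n | ~~ odd k]
      ++ rev [seq k <- iota 1 n | odd k && (1 < k)%N].

(* Main.v *)
Require Import Defs.
From HB Require Import structures.
From mathcomp Require Import all_boot all_order all_algebra.
From mathcomp Require Import reals.
From mathcomp Require Import zify ring lra.

Set Implicit Arguments.
Unset Strict Implicit.
Unset Printing Implicit Defensive.

Import Order.TTheory GRing.Theory Num.Theory.
Local Open Scope ring_scope.

(* Deleting the largest entry m of a loop, with neighbours a and b, lowers the
   loop cost by m^2 - (m - a)(m - b). By induction the rest costs at most the
   optimum for the remaining entries, and (m - a)(m - b) is smallest when a and b
   are the two largest of them; these are adjacent in the optimal rest, so both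
   bounds are attained together, and for distinct entries only by that loop.
   The pairwise cost of v is the loop cost of v with a 0 added. The pattern of
   size n + 1 is loop-equivalent to 1 followed by the reversed pattern of size n
   shifted up by one, so the pairwise problem is the loop problem for
   0, s_1, ..., s_n, whose entries are distinct exactly when s_1 > 0. *)

(** * Loop equivalence as a dihedral action *)

Section LoopEquiv.
Variable T : Type.
Implicit Types v w : seq T.

Lemma loop_equiv_trans v w x :
  loop_equiv v w -> loop_equiv w x -> loop_equiv v x.
Proof.
by move=> vw; elim=> // *; [exact: loop_equiv_rot | exact: loop_equiv_rev].
Qed.

Lemma loop_equiv_sym v w : loop_equiv v w -> loop_equiv w v.
Proof.
elim=> [|k {}w _ IH|{}w _ IH]; first exact: loop_equiv_refl.
- apply: loop_equiv_trans IH; rewrite -[X in loop_equiv _ X](rotK k).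
  by apply: loop_equiv_rot; exact: loop_equiv_refl.
- apply: loop_equiv_trans IH; rewrite -[X in loop_equiv _ X]revK.
  by apply: loop_equiv_rev; exact: loop_equiv_refl.
Qed.

Lemma rot_rot_ex j k v : exists i, rot j (rot k v) = rot i v.
Proof.
(* Rotation amounts add modulo the size only once they are capped by it. *)
rewrite (rot_minn k v) (rot_minn j) size_rot rot_add_mod ?geq_minr //.
by eexists.
Qed.

(** Moving a reversal past a rotation inverts the rotation, so all reversals can be collected first
    and cancelled in pairs. *)
Lemma loop_equivP v w :
  loop_equiv v w -> exists k, w = rot k v \/ w = rot k (rev v).
Proof.
elim=> [|k {}w _ [j [->|->]]|{}w _ [j [->|->]]].
- by exists 0%N; left; rewrite rot0.
- by have [i ->] := rot_rot_ex k j v; exists i; left.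
- by have [i ->] := rot_rot_ex k j (rev v); exists i; right.
- by exists (size v - j)%N; right; rewrite rev_rot /rotr size_rev.
- by exists (size v - j)%N; left; rewrite rev_rot revK.
Qed.

End LoopEquiv.

Lemma loop_equiv_map (T U : Type) (f : T -> U) (v w : seq T) :
  loop_equiv v w -> loop_equiv (map f v) (map f w).
Proof.
elim=> [|k {}w _ IH|{}w _ IH]; first exact: loop_equiv_refl.
- by rewrite map_rot; exact: loop_equiv_rot.
- by rewrite map_rev; exact: loop_equiv_rev.
Qed.

Lemma loop_equiv_perm (T : eqType) (v w : seq T) :
  loop_equiv v w -> perm_eq w v.
Proof.
by elim=> // *; rewrite ?perm_rot ?perm_rev.
Qed.

(** As [a] occurs only once, a rotation that keeps it in front changes nothing. *)
Lemma rot_uniq_cons (T : eqType) (a : T) (x y : seq T) k :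
  uniq (a :: x) -> rot k (a :: x) = a :: y -> x = y.
Proof.
case: k => [|k] /= /andP[ax _]; first by rewrite rot0 => -[].
rewrite /rot /=; case E: (drop k x) => [|b d] /= [].
  by move=> <-; rewrite -[LHS](cat_take_drop k) E cats0.
by move=> ba _; move: ax; rewrite -ba (@mem_drop k) // E mem_head.
Qed.

(** Cutting a loop at a marked entry leaves only the direction open. With [a = 0] this turns
    uniqueness of loops into uniqueness of paths. *)
Lemma loop_equiv_cons (T : eqType) (a : T) (x y : seq T) :
  uniq (a :: x) -> loop_equiv (a :: x) (a :: y) -> pairwise_equiv x y.
Proof.
move=> ux /loop_equivP[k [/esym/rot_uniq_cons|]]; first by left; auto.
rewrite rev_cons -rot1_cons => E.
have [i Ei] := rot_rot_ex k 1 (a :: rev x); rewrite Ei in E.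
right; rewrite -(rot_uniq_cons _ (esym E)) ?revK //.
by rewrite /= mem_rev rev_uniq.
Qed.

Lemma last_rev (T : Type) (a : T) x : last a (rev x) = head a x.
Proof. by case: x => //= b x; rewrite rev_cons last_rcons. Qed.

Lemma head_rev (T : Type) (a : T) x : head a (rev x) = last a x.
Proof. by rewrite -[in RHS](revK x) last_rev. Qed.

(** * Cost identities and invariance *)

Section Costs.
Variable R : realType.
Implicit Types (a b m h : R) (v w x y l : seq R).

Lemma pairwise_cost_cons a x :
  pairwise_cost (a :: x) = a * head 0 x + pairwise_cost x.
Proof.
rewrite /pairwise_cost; case: x => [|b x] /=; first by rewrite !big_geq ?mulr0 ?addr0.
by rewrite big_nat_recl.
Qed.

Lemma pairwise_cost_nil : pairwise_cost [::] = 0 :> R.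
Proof. exact: big_geq. Qed.

Lemma pairwise_cost_cat x y :
  pairwise_cost (x ++ y) =
  pairwise_cost x + last 0 x * head 0 y + pairwise_cost y.
Proof.
elim: x => [|a x IH] /=.
  by rewrite pairwise_cost_nil mul0r !add0r.
rewrite !pairwise_cost_cons IH; case: x {IH} => [|b x] /=; last by ring.
by rewrite pairwise_cost_nil; ring.
Qed.

Lemma pairwise_cost_rev x : pairwise_cost (rev x) = pairwise_cost x.
Proof.
elim: x => // a x IH; rewrite rev_cons -cats1 pairwise_cost_cat IH.
by rewrite !pairwise_cost_cons pairwise_cost_nil /= last_rev; ring.
Qed.

Lemma loop_costE x : loop_cost x = pairwise_cost x + last 0 x * head 0 x.
Proof. by rewrite /loop_cost nth_last nth0. Qed.

Lemma loop_cost_rot k x : loop_cost (rot k x) = loop_cost x.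
Proof.
rewrite /rot -[in RHS](cat_take_drop k x); move: (take k x) (drop k x) => y z.
rewrite !loop_costE !pairwise_cost_cat !last_cat.
by case: y z => [|b y] [|c z] //=; ring.
Qed.

Lemma loop_cost_rev x : loop_cost (rev x) = loop_cost x.
Proof.
by rewrite !loop_costE pairwise_cost_rev last_rev head_rev mulrC.
Qed.

Lemma loop_cost_equiv v w : loop_equiv v w -> loop_cost w = loop_cost v.
Proof. by elim=> // *; rewrite ?loop_cost_rot ?loop_cost_rev. Qed.

Lemma loop_cost0 x : loop_cost (0 :: x) = pairwise_cost x.
Proof. by rewrite loop_costE pairwise_cost_cons /= mul0r mulr0 add0r addr0. Qed.

(** With [a] and [b] the ends of [x], inserting [m] replaces the closing product [a b] by
    [m a + m b], and [m a + m b - a b = m^2 - (m - a)(m - b)]. *)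
Lemma loop_cost_cons m x : x != [::] ->
  loop_cost (m :: x) =
  loop_cost x + m ^+ 2 - (m - head 0 x) * (m - last 0 x).
Proof.
by case: x => // a x _; rewrite !loop_costE pairwise_cost_cons /=; ring.
Qed.

End Costs.

(* For [l] decreasing, each new maximum is put between the two largest of the
   remaining entries. *)
Definition best_loop (T : Type) (l : seq T) : seq T :=
  foldr (fun m t => m :: rev (rot 1 t)) [::] l.

Lemma best_loop_cons (T : Type) (m : T) (l : seq T) :
  best_loop (m :: l) = m :: rev (rot 1 (best_loop l)).
Proof. by []. Qed.

Arguments best_loop : simpl never.

Lemma best_loop_map (T U : Type) (f : T -> U) (l : seq T) :
  best_loop (map f l) = map f (best_loop l).
Proof. by elim: l => // m l IH; rewrite !best_loop_cons /= IH map_rev map_rot. Qed.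

Lemma perm_best_loop (T : eqType) (l : seq T) : perm_eq (best_loop l) l.
Proof. by elim: l => // m l IH; rewrite best_loop_cons perm_cons perm_rev perm_rot. Qed.

(** After [rot 1] these two entries are the ends of the list, and the next maximum is inserted
    between them. *)
Lemma best_loop_cons2 (T : Type) (h h' : T) (l : seq T) :
  exists z, best_loop (h :: h' :: l) = h :: h' :: z.
Proof.
rewrite !best_loop_cons rot1_cons rev_rcons; by eexists.
Qed.

(** * Optimality and uniqueness of the greedy loop *)

Section BestLoop.
Variable R : realType.
Implicit Types (a b m h : R) (v w x y l : seq R).

(** The ends sit at different positions, so if one of them uses up [h], the other comes from
    [h' :: l]. *)
Lemma ends_le h h' l x :
  h' <= h -> all (<= h') l -> perm_eq x (h :: h' :: l) ->
  (head 0 x <= h /\ last 0 x <= h') \/ (head 0 x <= h' /\ last 0 x <= h).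
Proof.
move=> hh' lh; case: x => [|a x]; first by move/perm_size.
case/lastP: x => [|x b]; first by move/perm_size.
rewrite /= last_rcons => P.
have le_h' c : c \in h' :: l -> c <= h'.
  by rewrite inE => /orP[/eqP->//|/(allP lh)].
have le_h c : c \in h :: h' :: l -> c <= h.
  by rewrite inE => /orP[/eqP->//|/le_h' /le_trans]; exact.
have [ah|ah] := eqVneq a h.
  left; split; first by rewrite ah.
  by apply: le_h'; move: P; rewrite ah perm_cons => /perm_mem <-;
     rewrite mem_rcons mem_head.
right; split; last first.
  by apply: le_h; rewrite -(perm_mem P) inE mem_rcons mem_head orbT.
by apply: le_h'; move: (mem_head a (rcons x b)); rewrite (perm_mem P) inE (negbTE ah).
Qed.

Lemma loop_cost_best_cons m h h' l :
  loop_cost (best_loop [:: m, h, h' & l]) =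
  loop_cost (best_loop [:: h, h' & l]) + m ^+ 2 - (m - h) * (m - h').
Proof.
rewrite best_loop_cons loop_cost_cons ?loop_cost_rev ?loop_cost_rot.
  have [z ->] := best_loop_cons2 h h' l.
  by rewrite rot1_cons rev_rcons /= last_rev.
by rewrite -size_eq0 size_rev size_rot.
Qed.

(** The order is weak so that the bound also covers [0 :: s] when the smallest entry of [s] is 0. *)
Lemma loop_cost_le_best l v :
  sorted >=%R l -> perm_eq v l -> loop_cost v <= loop_cost (best_loop l).
Proof.
elim: l v => [|m l IH] v sl vl.
  by move/perm_size/size0nil: vl => ->.
have mv : m \in v by rewrite (perm_mem vl) mem_head.
have [i x Ex] := rot_to mv; rewrite -(loop_cost_rot i) Ex.
have xl : perm_eq x l by rewrite -(perm_cons m) -Ex perm_rot.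
case: l IH {vl} xl sl => [|h [|h' l]] IH xl sl.
- by move/perm_size/size0nil: xl => ->.
- by rewrite (perm_small_eq _ xl).
have x0 : x != [::] by case: (x) xl => // /perm_size.
rewrite loop_cost_cons // loop_cost_best_cons.
have /= /andP[hm /andP[h'h pl]] := sl.
have lh' : all (<= h') l.
  by apply: order_path_min pl => a b c /= ba cb; exact: le_trans cb ba.
have := IH x (path_sorted sl) xl.
(* Up to swapping the ends [a], [b] of [x], [0 <= m - h <= m - a] and [0 <= m - h' <= m - b], so the
   products compare. *)
have [] := ends_le h'h lh' xl => -[] a_le b_le; nra.
Qed.

(** Putting the maximum first and its larger neighbour right after it fixes rotation and direction,
    so the induction can prove an equality of lists. *)
Lemma loop_cost_best_uniq m l x :
  sorted >%R (m :: l) -> perm_eq x l -> last 0 x <= head 0 x ->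
  loop_cost (best_loop (m :: l)) <= loop_cost (m :: x) ->
  m :: x = best_loop (m :: l).
Proof.
elim: l m x => [|h [|h' l] IH] m x sl xl ends opt.
- by move/perm_size/size0nil: xl => ->.
- by rewrite (perm_small_eq _ xl).
have x0 : x != [::] by case: (x) xl => // /perm_size.
have /= /andP[hm /andP[h'h pl]] := sl.
have lh' : all (< h') l.
  by apply: order_path_min pl => a b c /= ba cb; exact: lt_trans cb ba.
have {}lh' : all (<= h') l by apply: sub_all lh' => ?; exact: ltW.
have le_x : loop_cost x <= loop_cost (best_loop [:: h, h' & l]).
  apply: loop_cost_le_best xl.
  by apply: sub_sorted (path_sorted sl) => ? ?; exact: ltW.
rewrite loop_cost_cons // loop_cost_best_cons in opt.
(* The rest and the product are bounded separately; attaining the total forces equality in both. *)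
have {opt le_x} [opt prod] : loop_cost (best_loop [:: h, h' & l]) <= loop_cost x
    /\ (m - head 0 x) * (m - last 0 x) <= (m - h) * (m - h').
  by have [] := ends_le (ltW h'h) lh' xl => -[] a_le b_le; split; nra.
have [hx lx] : head 0 x = h /\ last 0 x = h'.
  have [] := ends_le (ltW h'h) lh' xl => -[] a_le b_le.
    by split; apply/eqP; rewrite eq_le ?a_le ?b_le /= leNgt; apply/negP; nra.
  (* Here [last 0 x <= head 0 x <= h' < h], so the product is strictly too large. *)
  exfalso; have : head 0 x < h by lra.
  have : last 0 x < h by lra.
  nra.
case: x x0 xl ends opt prod hx lx => // a y _ xl _ opt _ ah lx.
rewrite /= in ah lx; rewrite {}ah in xl opt *; rewrite perm_cons in xl.
(* [y] ends in [h']; reversing it puts [h'] right after [h], as the direction convention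
   requires. *)
have E : h :: rev y = best_loop [:: h, h' & l].
  apply: IH; rewrite ?perm_rev //; first exact: path_sorted sl.
    rewrite last_rev head_rev; case: y xl lx {opt} => [/perm_size//|b y] yl /= ->.
    by move: (mem_head b y); rewrite (perm_mem yl) inE => /orP[/eqP->|/(allP lh')].
  by rewrite -rev_rcons -rot1_cons loop_cost_rev loop_cost_rot.
by rewrite best_loop_cons -E rot1_cons rev_rcons revK.
Qed.

Lemma loop_equiv_best l v :
  sorted >%R l -> perm_eq v l ->
  loop_cost (best_loop l) <= loop_cost v -> loop_equiv v (best_loop l).
Proof.
case: l => [|m l] sl vl opt.
  by move/perm_size/size0nil: vl => ->; exact: loop_equiv_refl.
have mv : m \in v by rewrite (perm_mem vl) mem_head.
have [i x Ex] := rot_to mv; rewrite -(loop_cost_rot i v) Ex in opt.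
have xl : perm_eq x l by rewrite -(perm_cons m) -Ex perm_rot.
have vx : loop_equiv v (m :: x).
  by rewrite -Ex; apply: loop_equiv_rot; exact: loop_equiv_refl.
have [ends|/ltW ends] := leP (last 0 x) (head 0 x).
  by rewrite -(loop_cost_best_uniq sl xl).
rewrite -(@loop_cost_best_uniq m l (rev x)) ?perm_rev //.
- rewrite -rev_rcons -rot1_cons.
  by apply: loop_equiv_rev; apply: loop_equiv_rot.
- by rewrite last_rev head_rev.
- by rewrite -rev_rcons -rot1_cons loop_cost_rev loop_cost_rot.
Qed.

End BestLoop.

(** * The greedy loop on ranks and the two patterns *)

Lemma iota_rcons m n : iota m n.+1 = rcons (iota m n) (m + n)%N.
Proof. by rewrite -cats1 -(addn1 n) iotaD. Qed.

(** From the maximum the loop descends through the other parity and climbs back through its own; the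
    reversal in each greedy step exchanges these two runs. *)
Lemma best_loop_iota n :
  best_loop (rev (iota 1 n.+1)) =
  n.+1 :: (if odd n.+1
    then rev [seq k <- iota 1 n | ~~ odd k] ++ [seq k <- iota 1 n | odd k]
    else rev [seq k <- iota 1 n | odd k] ++ [seq k <- iota 1 n | ~~ odd k]).
Proof.
elim: n => // n IH; rewrite iota_rcons rev_rcons best_loop_cons IH rot1_cons.
rewrite rev_rcons iota_rcons !filter_rcons !add1n /=.
by case: (odd n); rewrite /= rev_cat revK ?rev_rcons.
Qed.

Lemma loop_equiv_pattern n :
  loop_equiv (best_loop (rev (iota 1 n))) (loop_pattern n).
Proof.
case: n => [|n]; first exact: loop_equiv_refl.
rewrite best_loop_iota /loop_pattern iota_rcons !filter_rcons add1n /=.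
move: [seq k <- iota 1 n | ~~ odd k] [seq k <- iota 1 n | odd k] => E O.
apply: loop_equiv_sym; case: (odd n) => /=.
  rewrite cat_rcons -cat_cons -(rot_size_cat E).
  by apply: loop_equiv_rot; exact: loop_equiv_refl.
(* For an odd maximum the two lists run in opposite directions, so a reversal is needed too. *)
have -> : n.+1 :: rev E ++ O = rot (size O) (rev (E ++ rev (rcons O n.+1))).
  by rewrite rev_cat revK -cats1 -catA rot_size_cat.
by apply: loop_equiv_rot; apply: loop_equiv_rev; exact: loop_equiv_refl.
Qed.

Lemma even_iota n :
  [seq k <- iota 1 n.+1 | ~~ odd k] = map succn [seq k <- iota 1 n | odd k].
Proof.
rewrite /= (iotaDl 1 1) filter_map; congr map.
by apply: eq_filter => k /=; rewrite negbK.
Qed.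

Lemma odd_iota n :
  [seq k <- iota 1 n.+1 | odd k] =
  1%N :: map succn [seq k <- iota 1 n | ~~ odd k].
Proof. by rewrite /= (iotaDl 1 1) filter_map. Qed.

(** Adding one exchanges the parities, hence the increasing and decreasing runs; the new 1 closes
    the odd run. *)
Lemma loop_patternS n :
  loop_pattern n.+1 = rcons (map succn (rev (loop_pattern n))) 1%N.
Proof.
rewrite {1}/loop_pattern even_iota odd_iota rev_cons -rcons_cat.
by rewrite /loop_pattern rev_cat revK map_cat map_rev.
Qed.

Lemma shifted_patternS n :
  shifted_pattern n.+1 = 1%N :: map succn (rev (loop_pattern n)).
Proof.
rewrite /shifted_pattern even_iota; have -> :
    [seq k <- iota 1 n.+1 | odd k && (1 < k)%N] =
    map succn [seq k <- iota 1 n | ~~ odd k].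
  rewrite /= (iotaDl 1 1) filter_map; congr map; apply: eq_in_filter => k.
  by rewrite mem_iota /=; lia.
by rewrite /loop_pattern rev_cat revK map_cat map_rev.
Qed.

Lemma loop_equiv_shifted n :
  loop_equiv (loop_pattern n.+1) (shifted_pattern n.+1).
Proof.
rewrite shifted_patternS loop_patternS -rotr1_rcons.
by apply: loop_equiv_rot; exact: loop_equiv_refl.
Qed.

Lemma perm_loop_pattern n : perm_eq (loop_pattern n) (iota 1 n).
Proof.
apply: perm_trans (loop_equiv_perm (loop_equiv_pattern n)) _.
by apply: perm_trans (perm_best_loop _) _; rewrite perm_rev.
Qed.

(** * Arrangements order-isomorphic to a pattern *)

Section Arrange.
Variable R : realType.

(** Ranks in a pattern start at 1, list positions at 0. *)
Definition arrange (s : seq R) (p : seq nat) : seq R := [seq s`_k.-1 | k <- p].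

Lemma arrange_iota (s : seq R) : arrange s (iota 1 (size s)) = s.
Proof.
rewrite /arrange (iotaDl 1 0) -map_comp -[RHS](mkseq_nth 0).
by apply: eq_map.
Qed.

Lemma arrange_perm (s : seq R) (p : seq nat) :
  perm_eq p (iota 1 (size s)) -> perm_eq (arrange s p) s.
Proof. by move=> ps; rewrite -[X in perm_eq _ X]arrange_iota; exact: perm_map. Qed.

Lemma unique_arranged (s : seq R) (p : seq nat) :
  sorted <%R s -> perm_eq p (iota 1 (size s)) ->
  unique (arranged_as s p) (arrange s p).
Proof.
move=> ss pP; have szp : size p = size s by rewrite (perm_size pP) size_iota.
have up : uniq p by rewrite (perm_uniq pP) iota_uniq.
have p_bd i : (i < size s)%N -> (0 < nth 0%N p i <= size s)%N.
  move=> si; have : nth 0%N p i \in p by rewrite mem_nth ?szp.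
  by rewrite (perm_mem pP) mem_iota; lia.
split.
  split; first exact: arrange_perm.
  split; rewrite ?size_map ?szp //.
    by rewrite (perm_uniq (arrange_perm pP)); apply: lt_sorted_uniq.
  move=> i j si sj; rewrite !(nth_map 0%N) ?szp //.
  have := p_bd _ si; have := p_bd _ sj; move: (nth _ p i) (nth _ p j) => a b.
  move=> bb ba.
  have -> : (s`_a.-1 < s`_b.-1) = (a.-1 < b.-1)%N.
    have a_lt : (a.-1 < size s)%N by lia.
    have b_lt : (b.-1 < size s)%N by lia.
    exact: lt_sorted_ltn_nth.
  by split; lia.
move=> v [vs [uv _ iso]].
have szv : size v = size s := perm_size vs.
(* [f k] is the entry of [v] of rank [k]. Listed by rank, the entries of [v] form an increasing
   permutation of [s], hence [s] itself. *)
pose f k := v`_(index k p).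
have vE : v = map f p.
  apply: (@eq_from_nth _ 0); rewrite ?size_map szv ?szp // => i si.
  by rewrite (nth_map 0%N) ?szp // /f index_uniq ?szp.
have sE : map f (iota 1 (size s)) = s.
  apply: (@lt_sorted_eq _ _ _ _ _ ss) => [|x]; last first.
    have /perm_mem -> // : perm_eq (map f (iota 1 (size s))) s.
    by apply: perm_trans vs; rewrite [X in perm_eq _ X]vE perm_map // perm_sym.
  apply/(sortedP 0); rewrite size_map size_iota => i si.
  have ip k : (k < size s)%N -> k.+1 \in p.
    by rewrite (perm_mem pP) mem_iota; lia.
  rewrite !(nth_map 0%N) ?size_iota ?nth_iota ?add1n //; try lia.
  apply/iso; rewrite ?szv -?szp ?index_mem ?ip ?nth_index ?ip //; lia.
rewrite [RHS]vE; apply/eq_in_map => k; rewrite (perm_mem pP) mem_iota => kb.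
rewrite -{1}sE (nth_map 0%N) ?size_iota ?nth_iota; try lia.
by congr f; lia.
Qed.

Lemma loop_equiv_arrange (s : seq R) :
  loop_equiv (best_loop (rev s)) (arrange s (loop_pattern (size s))).
Proof.
rewrite -{1}(arrange_iota s) -map_rev best_loop_map.
by apply: loop_equiv_map; exact: loop_equiv_pattern.
Qed.

(** In [0 :: s] rank 1 is the added 0 and rank [k + 1] is the entry of rank [k] in [s], so the
    shifted pattern reads as 0 followed by the reversed arrangement. *)
Lemma loop_equiv_arrange0 (s : seq R) :
  loop_equiv (best_loop (rev (0 :: s)))
             (0 :: rev (arrange s (loop_pattern (size s)))).
Proof.
apply: loop_equiv_trans (loop_equiv_arrange (0 :: s)) _.
have := loop_equiv_map (fun k => (0 :: s)`_k.-1) (loop_equiv_shifted (size s)).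
rewrite shifted_patternS /= -map_comp => E.
rewrite /arrange -map_rev; congr (loop_equiv _ (_ :: _)): E.
apply/eq_in_map => k; rewrite mem_rev (perm_mem (perm_loop_pattern _)) mem_iota.
by case: k.
Qed.

End Arrange.

Theorem theorem9 (R : realType) (n : nat) (s : n.-tuple R)
    (hn : (2 <= n)%N)
    (s_incr : forall i j : nat, (i < j)%N -> (j < n)%N -> s`_i < s`_j)
    (s_ge0 : forall i : nat, (i < n)%N -> 0 <= s`_i) :
  exists u w : seq R,
    unique (arranged_as s (loop_pattern n)) u /\
    unique (arranged_as s (shifted_pattern n)) w /\
    (forall v : seq R, perm_eq v s ->
       (has_maximal (@loop_cost R) s v <-> loop_equiv v u)) /\
    has_maximal (@pairwise_cost R) s u /\
    (0 < s`_0 ->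
       forall v : seq R, has_maximal (@pairwise_cost R) s v ->
         pairwise_equiv v u) /\
    (s`_0 = 0 ->
       has_maximal (@pairwise_cost R) s w /\
       has_maximal (@pairwise_cost R) s (rev w)).
Proof.
have sz : size s = n := size_tuple s.
have ss : sorted <%R s by apply/(sortedP 0) => i; rewrite sz ; exact: s_incr.
have sv : sorted >%R (rev s) by rewrite rev_sorted.
have perm_rev_s v : perm_eq v (rev s) = perm_eq v s by rewrite perm_sym perm_rev perm_sym.
have s0 : s`_0 = head 0 s by rewrite nth0.
have sorted0 : sorted >=%R (rev (0 :: s)).
  rewrite rev_sorted /=; have := sub_sorted (@ltW _ _) ss.
  by case: (tval s) s0 (s_ge0 0%N (ltnW hn)) => //= a s' _ ->.
pose u := arrange s (loop_pattern n); pose w := arrange s (shifted_pattern n).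
have Pu : perm_eq (loop_pattern n) (iota 1 (size s)).
  by rewrite sz; exact: perm_loop_pattern.
have [k n_k] : exists k, n = k.+1 by exists n.-1; lia.
have PQ : loop_equiv (loop_pattern n) (shifted_pattern n).
  by rewrite n_k; exact: loop_equiv_shifted.
have Pn : loop_pattern n = rcons (map succn (rev (loop_pattern k))) 1%N.
  by rewrite n_k loop_patternS.
have Qn : shifted_pattern n = 1%N :: map succn (rev (loop_pattern k)).
  by rewrite n_k shifted_patternS.
have Pw : perm_eq (shifted_pattern n) (iota 1 (size s)).
  exact: perm_trans (loop_equiv_perm PQ) Pu.
have us : perm_eq u s := arrange_perm Pu.
have ws : perm_eq w s := arrange_perm Pw.
have best_u : loop_equiv (best_loop (rev s)) u.
  by have := loop_equiv_arrange s; rewrite sz.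
have best_u0 : loop_equiv (best_loop (rev (0 :: s))) (0 :: rev u).
  by have := loop_equiv_arrange0 s; rewrite sz.
have max_u v : perm_eq v s -> pairwise_cost v <= pairwise_cost u.
  move=> vs; rewrite -(pairwise_cost_rev u) -!loop_cost0 (loop_cost_equiv best_u0).
  by apply: loop_cost_le_best sorted0 _; rewrite perm_sym perm_rev perm_cons perm_sym.
exists u, w; split; first exact: unique_arranged.
split; first exact: unique_arranged.
split.
  move=> v vs; split => [[_ max_v]|vu].
    apply: loop_equiv_trans best_u; apply: loop_equiv_best => //.
      by rewrite perm_rev_s.
    by apply: max_v; rewrite -perm_rev_s perm_best_loop.
  split=> // v' v's; rewrite -(loop_cost_equiv vu) (loop_cost_equiv best_u).
  apply: loop_cost_le_best; last by rewrite perm_rev_s.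
  by apply: sub_sorted sv => x y; exact: ltW.
split; first by split.
split=> [s0_gt0 v [vs max_v]|s0_eq0].
  have ss0 : sorted <%R (0 :: s).
    by rewrite /=; case: (tval s) ss s0 s0_gt0 => //= a s' -> _ ->.
  have vs0 : perm_eq (0 :: v) (0 :: s) by rewrite perm_cons.
  have u0v : uniq (0 :: v) by rewrite (perm_uniq vs0) lt_sorted_uniq.
  have vu0 : loop_equiv (0 :: v) (0 :: rev u).
    apply: loop_equiv_trans (best_u0); apply: loop_equiv_best.
    - by rewrite rev_sorted.
    - by rewrite perm_sym perm_rev perm_sym.
    - by rewrite -(loop_cost_equiv best_u0) !loop_cost0 pairwise_cost_rev max_v.
  by have [->|->] := loop_equiv_cons u0v vu0; [right | left; rewrite revK].
(* [u] and [w] are loop-equivalent, and both closing products vanish: [u] ends and [w] starts with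
   the entry 0. *)
have wu : pairwise_cost w = pairwise_cost u.
  have uw : loop_cost w = loop_cost u.
    by apply: loop_cost_equiv; exact: loop_equiv_map.
  have Eu : loop_cost u = pairwise_cost u.
    by rewrite loop_costE /u Pn /arrange map_rcons last_rcons s0_eq0 mul0r addr0.
  by rewrite -Eu -uw loop_costE /w Qn /= s0_eq0 mulr0 addr0.
by split; split; rewrite ?perm_rev // => v vs; rewrite ?pairwise_cost_rev wu max_u.
Qed.
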